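(* Every $n\times n$ oscillatory matrix $A$ satisfies $$e_k(A)\le\max\{k,n-k\},\qquad 1\le k<n.$$ The bound is sharp for every pair $(n,k)$: for every $n\ge2$ and every $1\le k<n$ there is an $n\times n$ oscillatory matrix $A$ with $e_k(A)=\max\{k,n-k\}$.
   Context: All matrices are real and have order $n\ge2$. A matrix is totally nonnegative (TN) if all its minors are $\ge0$ and totally positive (TP) if all its minors are $>0$; a square TN matrix is oscillatory if some positive power of it is TP. For an oscillatory matrix $A$ and $1\le k\le n$, $e_k(A)=\min\{m\ge1:\text{all minors of order }k\text{ of }A^m\text{ are positive}\}$. *)

(* Defs.v *)
From HB Require Import structures.
From mathcomp Require Import all_boot all_order all_algebra.
From mathcomp Require Import reals.

Set Implicit Arguments.
Unset Strict Implicit.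
Unset Printing Implicit Defensive.

Import Order.TTheory GRing.Theory Num.Theory.
Local Open Scope ring_scope.

Definition strictly_increasing (k n : nat) (f : {ffun 'I_k -> 'I_n}) : bool :=
  [forall i : 'I_k, forall j : 'I_k, (i < j)%N ==> (f i < f j)%N].

(* Rows f 0 < f 1 < ... and columns g 0 < g 1 < ... are selected. The minor of
   order 0 is 1, and there is no strictly increasing f when k > n, so
   quantifying over every order k : nat below covers exactly the minors of
   orders 1, ..., n. *)
Definition minor (R : realType) (k n : nat) (f g : {ffun 'I_k -> 'I_n})
    (A : 'M[R]_n) : R :=
  \det (mxsub f g A).

Definition nonneg_minors (R : realType) (n k : nat) (A : 'M[R]_n) : bool :=
  [forall f : {ffun 'I_k -> 'I_n}, forall g : {ffun 'I_k -> 'I_n},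
    strictly_increasing f && strictly_increasing g ==> (0 <= minor f g A)].

Definition pos_minors (R : realType) (n k : nat) (A : 'M[R]_n) : bool :=
  [forall f : {ffun 'I_k -> 'I_n}, forall g : {ffun 'I_k -> 'I_n},
    strictly_increasing f && strictly_increasing g ==> (0 < minor f g A)].

Definition totally_nonnegative (R : realType) (n : nat) (A : 'M[R]_n) : Prop :=
  forall k : nat, nonneg_minors k A.

Definition totally_positive (R : realType) (n : nat) (A : 'M[R]_n) : Prop :=
  forall k : nat, pos_minors k A.

Definition oscillatory (R : realType) (n : nat) (A : 'M[R]_n) : Prop :=
  totally_nonnegative A /\
  exists m : nat, (1 <= m)%N /\ totally_positive (A ^+ m).

Lemma oscillatory_pos_minors (R : realType) (n : nat) (A : 'M[R]_n)
    (oscA : oscillatory A) (k : nat) :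
  exists m : nat, (1 <= m)%N && pos_minors k (A ^+ m).
Proof. by case: oscA => _ [m [m_gt0 tpAm]]; exists m; rewrite m_gt0 tpAm. Qed.

(* e_k(A). The proof that A is oscillatory is an argument because it guarantees
   that the minimum is over a nonempty set. *)
Definition minors_exponent (R : realType) (n : nat) (A : 'M[R]_n)
    (oscA : oscillatory A) (k : nat) : nat :=
  ex_minn (oscillatory_pos_minors oscA k).

(* Main.v *)
Require Import Defs.
From mathcomp Require Import all_boot all_order all_fingroup all_algebra.
From mathcomp Require Import reals zify ring lra.
Set Implicit Arguments.
Unset Strict Implicit.
Unset Printing Implicit Defensive.
Import Order.TTheory GRing.Theory Num.Theory.
Local Open Scope ring_scope.

(** An invertible totally nonnegative matrix is a product of elementary
    bidiagonal factors: down-moves, a positive diagonal, then up-moves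
    ([factorization], by Neville elimination). Multiplication by such a factor
    acts on minors without cancellation. If the selected rows are seen as [k]
    particles on [n] sites, an up-move lets the particle at [c] go to [c + 1] when
    that site is free. Hence a minor of the product is positive if and only if the
    word of factors can take the particles from the selected rows to the selected
    columns ([factored_gt0], [factored_inv]). The matrix is oscillatory exactly
    when all up-moves and all down-moves occur ([positive_complete], [minors_gt0]).

    Two minors of [A ^+ m] decide about all others of order [k]: the upper right
    and the lower left corner. Indeed, factor [A ^+ m] in turn; if its up-moves can
    take the particles from the lowest to the highest selection, they can also
    take them to any selection in between, by stopping each particle in time
    ([corners_suffice]).

    It remains to bring the particles from the lowest to the highest selection,
    reading once per round a word [w] that contains every up-move, of which only
    the first occurrences are used. Whether a particle, having crossed a gap, can
    cross the next one in the same round is determined by the order of the two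
    moves in [w]. Let [descents c] be the number of gaps below [c] that come after
    their upper neighbour in [w]. Particle [q] can cross gap [c] in round
    [k - 1 - q + descents c - descents (k - 1)]: this formula is compatible both with the order of the gaps and with the condition
    that particle [q + 1] has left the next site. As [descents] grows by [0] or [1]
    per gap, the last crossing happens before round [max k (n - k)]
    ([site_finish]).

    If [w] is the descending word, a particle advances only one site per round,
    which takes [n - k] rounds; if it is the ascending word, only one particle can
    start per round, which takes [k] rounds. This gives sharpness
    ([slow_example]). *)

(** * Increasing selections and minors *)

Definition sincr k n (f : 'I_k -> 'I_n) :=
  forall i j : 'I_k, (i < j)%N -> (f i < f j)%N.

Definition upd (T : eqType) (U : Type) (f : T -> U) a v :=
  fun i => if i == a then v else f i.

Lemma updx (T : eqType) (U : Type) (f : T -> U) a v : upd f a v a = v.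
Proof. by rewrite /upd eqxx. Qed.

Lemma upd_neq (T : eqType) (U : Type) (f : T -> U) a v i :
  i != a -> upd f a v i = f i.
Proof. by rewrite /upd => /negbTE->. Qed.

Lemma updid (T : eqType) (U : Type) (f : T -> U) a : upd f a (f a) =1 f.
Proof. by move=> i; rewrite /upd; case: eqP => // ->. Qed.

Lemma sincr_inj k n (f : 'I_k -> 'I_n) : sincr f -> injective f.
Proof.
move=> fP i j eqf; apply/val_inj => /=.
by case: (ltngtP i j) => // /fP; rewrite eqf ltnn.
Qed.

Lemma sincr_ge k n (f : 'I_k -> 'I_n) : sincr f -> forall i : 'I_k, (i <= f i)%N.
Proof.
move=> fP [i ik]; elim: i ik => //= i IH ik.
have ik' : (i < k)%N by exact: ltnW.
apply: leq_ltn_trans (IH ik') _; exact: fP.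
Qed.

Lemma sincr_le k n (f : 'I_k -> 'I_n) :
  sincr f -> forall i : 'I_k, (f i + k <= n + i)%N.
Proof.
move=> fP [i ik]; move def_d: (k - i.+1)%N => d.
elim: d i ik def_d => [|d IH] i ik def_d /=.
  by have := ltn_ord (f (Ordinal ik)); lia.
have ik' : (i.+1 < k)%N by lia.
have /= := IH _ ik' ltac:(lia).
have := fP (Ordinal ik) (Ordinal ik') (ltnSn _); lia.
Qed.

Lemma sincr_comp k l n (f : 'I_l -> 'I_n) (g : 'I_k -> 'I_l) :
  sincr f -> sincr g -> sincr (f \o g).
Proof. by move=> fP gP i j /gP/fP. Qed.

Lemma sincr_lift k (a : 'I_k) : sincr (lift a).
Proof. by move=> i j; rewrite /= /bump; lia. Qed.

Lemma eq_sincr k n (f g : 'I_k -> 'I_n) : f =1 g -> sincr f -> sincr g.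
Proof. by move=> e fP i j; rewrite -!e; exact: fP. Qed.

(** The selections with the same image coincide; this is why the identity
    matrix has no nonzero minors apart from the principal ones. *)
Lemma sincr_image k n (f g : 'I_k -> 'I_n) :
  sincr f -> sincr g -> (forall i, exists j, f i = g j) -> f =1 g.
Proof.
move=> fP gP im.
have {}im i : exists j, f i == g j by have [j ->] := im i; exists j.
pose s i := xchoose (im i).
have sE i : f i = g (s i) by apply/eqP/(xchooseP (im i)).
have sP : sincr s.
  move=> i j ij; rewrite ltnNge; apply/negP.
  rewrite leq_eqVlt => /predU1P[/val_inj e|/gP].
    by have := fP _ _ ij; rewrite !sE e ltnn.
  by rewrite -!sE; have := fP _ _ ij; lia.
move=> i; rewrite sE; congr g; apply/val_inj.
by have := sincr_ge sP i; have := sincr_le sP i => /=; lia.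
Qed.

Section Minors.
Variable R : comNzRingType.

Definition mnr k m n (f : 'I_k -> 'I_m) (g : 'I_k -> 'I_n) (A : 'M[R]_(m, n)) : R :=
  \det (mxsub f g A).

Lemma eq_mnr k m n (f f' : 'I_k -> 'I_m) (g g' : 'I_k -> 'I_n) (A : 'M[R]_(m, n)) :
  f =1 f' -> g =1 g' -> mnr f g A = mnr f' g' A.
Proof. by move=> ef eg; congr (\det _); apply/matrixP => i j; rewrite !mxE ef eg. Qed.

Lemma mnr_tr k m n (f : 'I_k -> 'I_m) (g : 'I_k -> 'I_n) (A : 'M[R]_(m, n)) :
  mnr g f A^T = mnr f g A.
Proof. by rewrite /mnr -trmx_mxsub det_tr. Qed.

Lemma mnr1 m n (i : 'I_m) (j : 'I_n) (A : 'M[R]_(m, n)) :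
  mnr (fun _ : 'I_1 => i) (fun _ => j) A = A i j.
Proof. by rewrite /mnr det_mx11 mxE. Qed.

Lemma mnr_dup k m n (f : 'I_k -> 'I_m) (g : 'I_k -> 'I_n) A a b :
  a != b -> f a = f b -> mnr f g A = 0.
Proof.
by move=> ab e; apply: (determinant_alternate ab) => j; rewrite !mxE e.
Qed.

Lemma cofactor_upd k m n (f : 'I_k -> 'I_m) (g : 'I_k -> 'I_n) (A : 'M[R]_(m, n))
    a x j :
  cofactor (mxsub (upd f a x) g A) a j = cofactor (mxsub f g A) a j.
Proof.
congr (_ * \det _).
by apply/matrixP => i l; rewrite !mxE upd_neq // eq_sym neq_lift.
Qed.

Lemma cofactor_mxsub k m n (f : 'I_k.+1 -> 'I_m) (g : 'I_k.+1 -> 'I_n)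
    (A : 'M[R]_(m, n)) a j :
  cofactor (mxsub f g A) a j = (-1) ^+ (a + j) * mnr (f \o lift a) (g \o lift j) A.
Proof. by congr (_ * \det _); apply/matrixP => i l; rewrite !mxE. Qed.

(** Expansion along row [a]: the cofactors do not see the row index [f a], so
    a minor depends linearly on the row placed there. *)
Lemma mnr_upd k m n (f : 'I_k -> 'I_m) (g : 'I_k -> 'I_n) (A : 'M[R]_(m, n)) a x :
  mnr (upd f a x) g A = \sum_j A x (g j) * cofactor (mxsub f g A) a j.
Proof.
rewrite /mnr (expand_det_row _ a); apply: eq_bigr => j _.
by rewrite mxE updx cofactor_upd.
Qed.

Lemma mnr_swap k m n (f : 'I_k -> 'I_m) (g : 'I_k -> 'I_n) (A : 'M[R]_(m, n)) a b :
  a != b -> mnr (f \o tperm a b) g A = - mnr f g A.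
Proof.
move=> ab; rewrite /mnr (_ : mxsub _ _ _ = xrow a b (mxsub f g A)).
  by rewrite xrowE det_mulmx det_perm odd_tperm ab expr1 mulN1r.
by apply/matrixP => i j; rewrite !mxE.
Qed.

Lemma mnr_col_single k m n (f : 'I_k -> 'I_m) (g : 'I_k -> 'I_n) (A : 'M[R]_(m, n))
    a j :
  (forall i, i != a -> A (f i) (g j) = 0) ->
  mnr f g A = A (f a) (g j) * cofactor (mxsub f g A) a j.
Proof.
move=> z; rewrite /mnr (expand_det_col _ j) (bigD1 a) //= big1 ?addr0 ?mxE //.
by move=> i /z fi; rewrite mxE fi mul0r.
Qed.

(** The Grassmann-Pluecker exchange relation between a minor of order [k] and
    one of order [l] on some of its columns: it is Cramer's rule, which writes
    the row [x] as a combination of the rows [f i]. *)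
Lemma mnr_exchange k l m n (f : 'I_k -> 'I_m) (g : 'I_k -> 'I_n) (h : 'I_l -> 'I_m)
    (p : 'I_l -> 'I_k) A s x :
  mnr f g A * mnr (upd h s x) (g \o p) A =
  \sum_i mnr (upd f i x) g A * mnr (upd h s (f i)) (g \o p) A.
Proof.
have cramer c : mnr f g A * A x (g c) = \sum_i mnr (upd f i x) g A * A (f i) (g c).
  set M := mxsub f g A.
  have /matrixP/(_ c c) : \adj M *m M = (\det M)%:M := mul_adj_mx M.
  pose v := \row_j A x (g j).
  have /matrixP/(_ 0 c) : v *m (\adj M *m M) = v *m (\det M)%:M.
    by rewrite mul_adj_mx.
  rewrite mulmxA mul_mx_scalar !mxE => <- _; apply: eq_bigr => i _.
  rewrite mnr_upd !mxE; congr (_ * _).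
  by apply: eq_bigr => j _; rewrite !mxE.
rewrite (mnr_upd h) mulr_sumr.
under [RHS]eq_bigr => i _ do rewrite (mnr_upd h) mulr_sumr.
rewrite exchange_big /=; apply: eq_bigr => j _.
by rewrite mulrA cramer mulr_suml; apply: eq_bigr => i _; rewrite mulrA.
Qed.

End Minors.

(** * Elementary row operations as moves of particles *)

(** A selection [f] is read as a row of particles, the [a]-th of them at [f a];
    since [f] is injective, at most one of them moves in a step. *)
Definition step n (u v : 'I_n) k (f g : 'I_k -> 'I_n) :=
  forall a, g a = f a \/ f a = u /\ g a = v.

Definition adj n (u v : 'I_n) := (v == u.+1 :> nat) || (u == v.+1 :> nat).

(** Adjacent positions have no position between them, so a particle keeps its
    rank when it moves to a free one. *)
Lemma sincr_upd k n (f : 'I_k -> 'I_n) a v :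
  sincr f -> adj (f a) v -> (forall b, f b != v) -> sincr (upd f a v).
Proof.
move=> fP uv free i j ij; rewrite /upd.
case: eqP => [ia|_]; case: eqP => [ja|_].
- by move: ij; rewrite ia ja ltnn.
- have := fP _ _ ij; rewrite ia.
  have : f j != v :> nat by apply/negP => /eqP/val_inj/eqP; apply/negP.
  by move: uv; rewrite /adj; lia.
- have := fP _ _ ij; rewrite ja.
  have : f i != v :> nat by apply/negP => /eqP/val_inj/eqP; apply/negP.
  by move: uv; rewrite /adj; lia.
- exact: fP.
Qed.

Section Words.
Variables (R : realFieldType) (n : nat).
Implicit Types (A B : 'M[R]_n) (u v : 'I_n) (t : R).

Definition tn A :=
  forall k (f g : 'I_k -> 'I_n), sincr f -> sincr g -> 0 <= mnr f g A.

Lemma tn_tr A : tn A -> tn A^T.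
Proof. by move=> tnA k f g fP gP; rewrite mnr_tr; exact: tnA. Qed.

Lemma tn_ge0 A i j : tn A -> 0 <= A i j.
Proof.
by move=> tnA; rewrite -(mnr1 i j A); apply: tnA => -[[]] // ? [[]].
Qed.

Lemma mnr_one k (f : 'I_k -> 'I_n) : injective f -> mnr f f (1%:M : 'M[R]_n) = 1.
Proof.
move=> fI; rewrite /mnr (_ : mxsub f f _ = 1%:M) ?det1 //.
by apply/matrixP => i j; rewrite !mxE (inj_eq fI).
Qed.

Lemma mnr_one_neq0 k (f g : 'I_k -> 'I_n) :
  sincr f -> sincr g -> mnr f g (1%:M : 'M[R]_n) != 0 -> f =1 g.
Proof.
move=> fP gP fg0; apply: sincr_image => // i.
case: (pickP (fun j => f i == g j)) => [j /eqP|none]; first by exists j.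
case/eqP: fg0; rewrite /mnr (expand_det_row _ i) big1 // => j _.
by rewrite !mxE none mul0r.
Qed.

Lemma tn1 : tn 1%:M.
Proof.
move=> k f g fP gP.
have [->//|/(mnr_one_neq0 fP gP) fg] := eqVneq (mnr f g (1%:M : 'M[R]_n)) 0.
by rewrite -(eq_mnr _ (frefl f) fg) mnr_one //; exact: sincr_inj.
Qed.

Definition elem u v t : 'M[R]_n := 1%:M + t *: delta_mx u v.

Lemma mul_elemE u v t B i j :
  (elem u v t *m B) i j = B i j + (i == u)%:R * (t * B v j).
Proof.
rewrite mulmxDl mul1mx -scalemxAl !mxE; congr (_ + _).
rewrite (bigD1 v) //= big1 => [|l lv]; first by rewrite mxE eqxx andbT addr0; ring.
by rewrite mxE (negbTE lv) andbF mul0r.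
Qed.

Lemma mnr_elem k (f g : 'I_k -> 'I_n) a v t B :
  injective f ->
  mnr f g (elem (f a) v t *m B) = mnr f g B + t * mnr (upd f a v) g B.
Proof.
move=> fI; have := mul_elemE (f a) v t B; move: (_ *m B) => C CE.
have lift_f i : (f (lift a i) == f a) = false.
  by rewrite (inj_eq fI) eq_sym (negbTE (neq_lift _ _)).
rewrite -[mnr f g B]mul1r; apply: (@determinant_multilinear _ _ _ _ _ a).
- by apply/rowP => j; rewrite !mxE CE eqxx updx !mul1r.
- by apply/matrixP => i j; rewrite !mxE CE lift_f mul0r addr0.
- apply/matrixP => i j; rewrite !mxE CE lift_f mul0r addr0 upd_neq //.
  by rewrite eq_sym neq_lift.
Qed.

Lemma mnr_elem_out k (f g : 'I_k -> 'I_n) u v t B :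
  (forall a, f a != u) -> mnr f g (elem u v t *m B) = mnr f g B.
Proof.
move=> fu; have := mul_elemE u v t B; move: (_ *m B) => C CE.
congr (\det _); apply/matrixP => i j.
by rewrite !mxE CE (negbTE (fu i)) mul0r addr0.
Qed.

Lemma mnr_upd_ge0 k (f g : 'I_k -> 'I_n) a v B :
  tn B -> sincr f -> sincr g -> adj (f a) v -> 0 <= mnr (upd f a v) g B.
Proof.
move=> tnB fP gP uv; case: (pickP (fun b => f b == v)) => [b /eqP fb|free].
  have ab : b != a by apply/eqP => ab; move: uv; rewrite -fb ab /adj; lia.
  by rewrite (@mnr_dup _ _ _ _ _ _ _ b a) ?updx ?upd_neq.
by apply: tnB => //; apply: sincr_upd => // b; rewrite free.
Qed.

Lemma tn_elem u v t B : adj u v -> 0 <= t -> tn B -> tn (elem u v t *m B).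
Proof.
move=> uv t0 tnB k f g fP gP; case: (pickP (fun a => f a == u)) => [a /eqP fa|fu].
  move: uv; rewrite -fa => uv; rewrite mnr_elem; last exact: sincr_inj.
  by apply: addr_ge0; [exact: tnB | apply: mulr_ge0 => //; exact: mnr_upd_ge0].
by rewrite mnr_elem_out ?tnB // => a; rewrite fu.
Qed.

(** On minors a row operation acts by moving a particle ([mnr_elem]). Both terms
    are nonnegative when [u] and [v] are adjacent, so there is no cancellation,
    and one positive term suffices. Conversely a positive sum has a positive
    term ([mnr_elem_inv]). *)
Lemma mnr_elem_gt0 k (f g h : 'I_k -> 'I_n) u v t B :
  adj u v -> 0 < t -> tn B -> sincr f -> sincr g -> sincr h -> step u v f g ->
  0 < mnr g h B -> 0 < mnr f h (elem u v t *m B).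
Proof.
move=> uv t0 tnB fP gP hP fg gh.
case: (pickP (fun a => f a == u)) => [a /eqP fa|fu]; last first.
  rewrite mnr_elem_out => [|a]; last by rewrite fu.
  rewrite (@eq_mnr _ _ _ _ _ g _ h) // => a.
  by case: (fg a) => // -[/eqP]; rewrite fu.
move: uv; rewrite -fa => uv; rewrite mnr_elem; last exact: sincr_inj.
have gE b : b != a -> g b = f b.
  move=> ba; case: (fg b) => // -[]; rewrite -fa => /(sincr_inj fP) ab.
  by rewrite ab eqxx in ba.
case: (fg a) => [ga|[_ ga]].
  rewrite ltr_wpDr //; first by apply: mulr_ge0; [exact: ltW | exact: mnr_upd_ge0].
  rewrite (@eq_mnr _ _ _ _ _ g _ h) // => b.
  by have [->|/gE] := eqVneq b a.
rewrite ltr_wpDl ?tnB // mulr_gt0 //.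
rewrite (@eq_mnr _ _ _ _ _ g _ h) // => b.
by have [->|ba] := eqVneq b a; rewrite ?updx ?upd_neq // gE.
Qed.

Lemma mnr_elem_inv k (f h : 'I_k -> 'I_n) u v t B :
  adj u v -> 0 < t -> tn B -> sincr f -> sincr h ->
  0 < mnr f h (elem u v t *m B) ->
  exists g, [/\ sincr g, step u v f g & 0 < mnr g h B].
Proof.
move=> uv t0 tnB fP hP.
have [f0 _|] := ltP 0 (mnr f h B); first by exists f; split=> // a; left.
have := tnB _ _ _ fP hP => f1 f2; have {f1 f2} f0 : mnr f h B = 0 by lra.
case: (pickP (fun a => f a == u)) => [a /eqP fa|fu]; last first.
  by rewrite mnr_elem_out ?f0 ?ltxx // => a; rewrite fu.
move: uv; rewrite -fa => uv; rewrite mnr_elem; last exact: sincr_inj.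
rewrite f0 add0r pmulr_rgt0 // => gt0.
exists (upd f a v); split=> // [|b].
  apply: sincr_upd => // b; apply/eqP => fb; move: gt0.
  have ab : b != a by apply/eqP => ab; move: uv; rewrite -fb ab /adj; lia.
  by rewrite (@mnr_dup _ _ _ _ _ _ _ b a) ?updx ?upd_neq ?ltxx.
by have [->|ba] := eqVneq b a; [right; rewrite updx | left; rewrite upd_neq].
Qed.

(** The letters of a word are elementary factors: source, target, weight. *)
Definition word := seq ('I_n * 'I_n * R).

Definition act (w : word) B := foldr (fun e C => elem e.1.1 e.1.2 e.2 *m C) B w.

Fixpoint reach (w : word) k (f g : 'I_k -> 'I_n) : Prop :=
  if w is e :: w' then exists f', [/\ sincr f', step e.1.1 e.1.2 f f' & reach w' f' g]
  else f =1 g.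

Definition pos_word (w : word) :=
  forall e, e \in w -> adj e.1.1 e.1.2 /\ 0 < e.2.

Definition raising (w : word) :=
  forall e, e \in w -> e.1.2 = e.1.1.+1 :> nat /\ 0 < e.2.

Definition lowering (w : word) :=
  forall e, e \in w -> e.1.1 = e.1.2.+1 :> nat /\ 0 < e.2.

Lemma pos_raising w : raising w -> pos_word w.
Proof. by move=> wP e /wP[ve ?]; rewrite /adj ve eqxx. Qed.

Lemma pos_lowering w : lowering w -> pos_word w.
Proof. by move=> wP e /wP[ve ?]; rewrite /adj ve eqxx orbT. Qed.

Lemma act_mul w B : act w B = act w 1%:M *m B.
Proof. by elim: w => [|e w IH] /=; rewrite ?mul1mx // IH mulmxA. Qed.

Lemma act_cat w w' B : act (w ++ w') B = act w (act w' B).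
Proof. by rewrite /act foldr_cat. Qed.

Lemma act_tn w B : pos_word w -> tn B -> tn (act w B).
Proof.
elim: w => //= e w IH wP tnB; have [adj_e e0] := wP e (mem_head _ _).
by apply: tn_elem; rewrite ?ltW //; apply: IH => // x xw; apply: wP; rewrite inE xw orbT.
Qed.

Lemma act_gt0 w k (f g h : 'I_k -> 'I_n) B :
  pos_word w -> tn B -> sincr f -> sincr h -> reach w f g ->
  0 < mnr g h B -> 0 < mnr f h (act w B).
Proof.
elim: w f => [|e w IH] f wP tnB fP hP /=; first by move=> fg; rewrite (@eq_mnr _ _ _ _ _ g _ h).
case=> f' [f'P ff' f'g] gh; have [adj_e e0] := wP e (mem_head _ _).
have wP' : pos_word w by move=> x xw; apply: wP; rewrite inE xw orbT.
by apply: mnr_elem_gt0 ff' (IH _ wP' tnB f'P hP f'g gh) => //; exact: act_tn.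
Qed.

Lemma act_inv w k (f h : 'I_k -> 'I_n) B :
  pos_word w -> tn B -> sincr f -> sincr h -> 0 < mnr f h (act w B) ->
  exists g, [/\ sincr g, reach w f g & 0 < mnr g h B].
Proof.
elim: w f => [|e w IH] f wP tnB fP hP /= gt0; first by exists f.
have [adj_e e0] := wP e (mem_head _ _).
have wP' : pos_word w by move=> x xw; apply: wP; rewrite inE xw orbT.
have [f' [f'P ff' f'h]] := mnr_elem_inv adj_e e0 (act_tn wP' tnB) fP hP gt0.
by have [g [gP f'g gh]] := IH _ wP' tnB f'P hP f'h; exists g; split=> //; exists f'.
Qed.

Lemma reach_refl w k (f : 'I_k -> 'I_n) : sincr f -> reach w f f.
Proof. by move=> fP; elim: w => //= e w IH; exists f; split=> // a; left. Qed.

Lemma reach_eq w k (f f' g g' : 'I_k -> 'I_n) :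
  f =1 f' -> g =1 g' -> reach w f g -> reach w f' g'.
Proof.
move=> ff' gg'; elim: w f f' ff' => [|e w IH] f f' ff' /=.
  by move=> fg a; rewrite -ff' fg gg'.
case=> h [hP fh hg]; exists h; split=> // [a|]; last exact: IH hg.
by rewrite -ff'.
Qed.

Lemma reach_sincr w k (f g : 'I_k -> 'I_n) : sincr f -> reach w f g -> sincr g.
Proof.
elim: w f => [|e w IH] f fP /=; first by move=> fg; exact: eq_sincr fg fP.
by case=> f' [f'P _]; exact: IH.
Qed.

Lemma reach_raising w k (f g : 'I_k -> 'I_n) :
  raising w -> reach w f g -> forall a, (f a <= g a)%N.
Proof.
elim: w f => [|e w IH] f wP /=; first by move=> e a; rewrite e.
case=> f' [_ ff' f'g] a; have [ve _] := wP e (mem_head _ _).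
have le1 : (f a <= f' a)%N by case: (ff' a) => [->//|[-> ->]]; rewrite ve.
by apply: leq_trans le1 (IH _ _ f'g a) => x xw; apply: wP; rewrite inE xw orbT.
Qed.

Lemma reach_lowering w k (f g : 'I_k -> 'I_n) :
  lowering w -> reach w f g -> forall a, (g a <= f a)%N.
Proof.
elim: w f => [|e w IH] f wP /=; first by move=> e a; rewrite e.
case=> f' [_ ff' f'g] a; have [ve _] := wP e (mem_head _ _).
have le1 : (f' a <= f a)%N by case: (ff' a) => [->//|[-> ->]]; rewrite ve.
by apply: leq_trans (IH _ _ f'g a) le1 => x xw; apply: wP; rewrite inE xw orbT.
Qed.

Definition clamp k (b f : 'I_k -> 'I_n) a := if (f a <= b a)%N then f a else b a.

Lemma sincr_clamp k (b f : 'I_k -> 'I_n) : sincr b -> sincr f -> sincr (clamp b f).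
Proof.
move=> bP fP i j ij; have := bP _ _ ij; have := fP _ _ ij.
by rewrite /clamp; case: ifP => ?; case: ifP => ?; lia.
Qed.

(** A journey can be cut short: every particle stops for good on reaching its
    own barrier. The barriers increase, so that a particle that has stopped is
    never in the way of the one behind it. The reason is the same for moves up
    and down: a single step does not jump over the barrier. *)
Lemma reach_clamp w k (b f g : 'I_k -> 'I_n) :
  pos_word w -> sincr b -> reach w f g -> reach w (clamp b f) (clamp b g).
Proof.
move=> wP bP; elim: w f wP => [|e w IH] f wP /=.
  by move=> fg a; rewrite /clamp fg.
case=> f' [f'P ff' f'g]; exists (clamp b f'); split; first exact: sincr_clamp.
  move=> a; have [adj_e _] := wP e (mem_head _ _).
  rewrite /clamp; case: (ff' a) => [->|[-> ->]]; first by left.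
  case: (leqP e.1.2 (b a)); case: (leqP e.1.1 (b a)) => l1 l2; [by right| | |by left];
    left; apply/val_inj; move: adj_e l1 l2; rewrite /adj /=; lia.
by apply: IH => // x xw; apply: wP; rewrite inE xw orbT.
Qed.

End Words.

(** * Neville elimination *)

Section Neville.
Variables (R : realFieldType) (n : nat).
Implicit Types (A B : 'M[R]_n).

Definition front k (x : 'I_n) (f : 'I_k -> 'I_n) (i : 'I_k.+1) :=
  if unlift ord0 i is Some j then f j else x.

Lemma front0 k (x : 'I_n) (f : 'I_k -> 'I_n) : front x f ord0 = x.
Proof. by rewrite /front unlift_none. Qed.

Lemma frontS k (x : 'I_n) (f : 'I_k -> 'I_n) j : front x f (lift ord0 j) = f j.
Proof. by rewrite /front liftK. Qed.

Lemma sincr_front k (x : 'I_n) (f : 'I_k -> 'I_n) :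
  sincr f -> (forall i, (x < f i)%N) -> sincr (front x f).
Proof.
move=> fP xf i j.
case: (unliftP ord0 i) => [i'|] ->; case: (unliftP ord0 j) => [j'|] ->;
  rewrite ?frontS ?front0 ?lift0 // ltnS; exact: fP.
Qed.

Variables (A : 'M[R]_n) (r r' c : 'I_n).
(* In the elimination, column [c] is the first one with a nonzero entry below the
   diagonal, and row [r] holds the last such entry. *)
Hypothesis tnA : tn A.
Hypothesis rr' : r = r'.+1 :> nat.
Hypothesis cr : (c < r)%N.
Hypothesis left_zero : forall i j : 'I_n, (j < c)%N -> (j < i)%N -> A i j = 0.
Hypothesis below_zero : forall i : 'I_n, (r < i)%N -> A i c = 0.

(** When no row lies above [r'], column [c] is put in front of the columns [g]:
    it vanishes in all rows but [r'] and [r], and expanding the bordered minor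
    along it gives the difference of the two sides. If some column of [g] is
    not to the right of [c], both sides are equal instead. *)
Lemma neville_top k (f g : 'I_k.+1 -> 'I_n) :
  sincr f -> sincr g -> f ord0 = r ->
  A r c * mnr (upd f ord0 r') g A <= A r' c * mnr f g A.
Proof.
move=> fP gP f0.
have f_gt i : i != ord0 -> (r < f i)%N.
  by move=> i0; rewrite -f0; apply: fP; rewrite lt0n.
case: (ltngtP (g ord0) c) => [gc|gc|/val_inj gc].
- have z (i : 'I_n) : (r' <= i)%N -> A i (g ord0) = 0.
    by move=> ri; apply: left_zero => //; move: rr' cr gc ri; lia.
  rewrite !(@mnr_col_single _ _ _ _ _ g _ ord0 ord0).
  + by rewrite updx f0 !z ?rr' // !mul0r !mulr0.
  + by move=> i /f_gt fi; apply: z; move: rr' fi; lia.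
  + by move=> i i0; rewrite upd_neq //; have /= fi := f_gt _ i0; apply: z; move: rr' fi; lia.
- pose F := front r' f; pose G := front c g.
  have FP : sincr F.
    apply: sincr_front => // i; have [->|/f_gt] := eqVneq i ord0; first by rewrite f0 rr'.
    by move: rr'; lia.
  have GP : sincr G.
    apply: sincr_front => // i; have [->//|i0] := eqVneq i ord0.
    by apply: ltn_trans gc _; apply: gP; rewrite lt0n.
  have := tnA FP GP; rewrite {1}/mnr (expand_det_col _ ord0) !big_ord_recl big1.
    rewrite addr0 !mxE !cofactor_mxsub /F /G front0 frontS front0 f0 /= /bump /=.
    rewrite !addn0 expr0 expr1 mul1r mulN1r mulrN subr_ge0.
    have Fr : front r' f \o lift ord0 =1 f by move=> i; exact: frontS.
    have Gr : front c g \o lift ord0 =1 g by move=> i; exact: frontS.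
    rewrite (eq_mnr _ Fr Gr) (eq_mnr A (f' := upd f ord0 r') _ Gr) // => i /=.
    have [->|i0] := eqVneq i ord0.
      by rewrite updx (_ : lift _ _ = ord0) ?front0 //; exact/val_inj.
    rewrite upd_neq // -[RHS](frontS r'); congr (front _ _ _).
    by apply/val_inj; rewrite /= /bump /=; move: i0; rewrite -val_eqE /=; case: (val i).
  move=> i _; rewrite !mxE /F /G front0 frontS below_zero ?mul0r //.
  by apply: f_gt; rewrite eq_sym neq_lift.
- have z i : i != ord0 -> A (f i) (g ord0) = 0.
    by move=> i0; rewrite gc; apply: below_zero; exact: f_gt.
  rewrite !(@mnr_col_single _ _ _ _ _ g _ ord0 ord0) //.
    by rewrite updx f0 gc cofactor_upd mulrCA.
  by move=> i i0; rewrite upd_neq // z.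
Qed.

(** The inequality that makes an elimination step preserve total
    nonnegativity: putting row [r'] in place of row [r] multiplies a minor by
    at most the ratio of the pivots. Induction on the number of rows above; the
    last of them is removed, together with one column, by an exchange
    relation, whose two extra terms have opposite signs. *)
Lemma neville_minor k (f g : 'I_k -> 'I_n) a :
  0 < A r' c -> sincr f -> sincr g -> f a = r ->
  (forall b : 'I_k, (b < a)%N -> (f b < r')%N) ->
  A r c * mnr (upd f a r') g A <= A r' c * mnr f g A.
Proof.
move=> pivot; move def_p: (val a) => p.
rewrite -[val a]/(nat_of_ord a) in def_p.
elim: p k f g a def_p => [|p IH] [|k] f g a def_p fP gP fa above; try by case: a fa def_p above.
  have a0 : a = ord0 by exact/val_inj.
  by rewrite a0 in fa *; exact: neville_top.
have pk : (p < k.+1)%N by have := ltn_ord a; rewrite /= in def_p *; lia.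
pose b := Ordinal pk; have ba : b != a by rewrite -val_eqE /= def_p; lia.
have fb : (f b < r')%N by apply: (above b) => /=.
pose f' := upd f a r'.
have f'P : sincr f'.
  apply: sincr_upd => [//||i]; first by rewrite /adj fa rr' eqxx orbT.
  apply/eqP => fi; have [ia|ia|/val_inj ia] := ltngtP i a.
  - by have := above i; rewrite -def_p ia fi ltnn => /(_ isT).
  - by have := fP _ _ ia; rewrite fi fa rr'; lia.
  - by move: rr'; rewrite -fi ia fa; lia.
have F'0 := tnA f'P gP; have F0 := tnA fP gP.
case: (ltgtP (mnr f' g A) 0) F'0 => // [F'0 _|-> _]; last first.
  by rewrite mulr0 mulr_ge0 // ltW.
(* The column removed with row [b] is chosen so that the smaller minor with row
   [r'] does not vanish, since it has to be cancelled at the end. *)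
have [j cof_j] : exists j, cofactor (mxsub f' g A) b j != 0.
  apply/existsP; apply: contraLR F'0; rewrite negb_exists => /forallP z.
  rewrite /mnr (expand_det_row _ b) big1 ?ltxx // => j _.
  by move/(_ j): z; rewrite negbK => /eqP->; rewrite mulr0.
have [s as_ _] := unlift_some ba.
pose h := f \o lift b; pose gj := g \o lift j.
have hP : sincr h by apply: sincr_comp => //; exact: sincr_lift.
have gjP : sincr gj by apply: sincr_comp => //; exact: sincr_lift.
have hs : h s = r by rewrite /h /= -as_.
have sp : val s = p by have := congr1 val as_; rewrite /= /bump def_p; case: leqP => /=; lia.
have upd_h x : upd f a x \o lift b =1 upd h s x.
  by move=> i; rewrite /= /upd as_ (inj_eq lift_inj).
have G'0 : 0 < mnr (upd h s r') gj A.
  rewrite lt_def (@eq_mnr _ _ _ _ _ (f' \o lift b) gj gj) //; last first.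
    by move=> i; rewrite -upd_h.
  rewrite tnA ?andbT //; last by apply: sincr_comp => //; exact: sincr_lift.
  by move: cof_j; rewrite cofactor_mxsub mulf_eq0 negb_or => /andP[].
have G0 : A r c * mnr (upd h s r') gj A <= A r' c * mnr h gj A.
  apply: IH => // i ip; apply: (above (lift b i)); rewrite /= /bump.
  by case: (leqP p i) => pi; move: ip pi; rewrite /=; lia.
have Gb : 0 <= mnr (upd h s (f b)) gj A.
  rewrite (@eq_mnr _ _ _ _ _ (f \o lift a) gj gj) ?tnA //.
    by apply: sincr_comp => //; exact: sincr_lift.
  move=> i; rewrite /upd /h /=; case: eqP => [->|/eqP si].
    by congr f; apply/val_inj; rewrite /= /bump def_p sp ltnn.
  congr f; apply/val_inj; rewrite /= /bump def_p.
  by move: si; rewrite -val_eqE /= sp; lia.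
(* Row [r] in the place of [b] comes just before row [r']; a swap sorts them. *)
have H0 : 0 <= - mnr (upd f' b r) g A.
  rewrite -(mnr_swap _ _ _ ba) (@eq_mnr _ _ _ _ _ (upd f b r') g g) ?tnA //.
    move=> i l il; rewrite /upd; case: eqP => [ib|/eqP ib]; case: eqP => [lb|/eqP lb].
    - by move: il; rewrite ib lb ltnn.
    - have [la|la|/val_inj->] := ltngtP l a; last by rewrite fa rr'.
        by move: il la; rewrite ib def_p /=; lia.
      by have := fP _ _ la; rewrite fa rr'; lia.
    - by apply: (above i); move: il; rewrite lb /=; lia.
    - exact: fP.
  move=> i; rewrite /= /f' /upd; case: tpermP => [->|->|/eqP/negbTE-> /eqP/negbTE->] //.
    by rewrite eqxx eq_sym (negbTE ba) eqxx.
  by rewrite eqxx eq_sym (negbTE ba) fa.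
have := mnr_exchange f' g h (lift j) A s r.
rewrite (bigD1 a) // (bigD1 b) //= big1 => [|i /andP[ia ib]]; last first.
  rewrite eq_sym in ib; have [i' def_i _] := unlift_some ib.
  have i's : i' != s by apply: contraNneq ia => i's; rewrite def_i i's -as_.
  rewrite (@mnr_dup _ _ _ _ (upd h s (f' i)) _ A i' s) ?mulr0 // updx upd_neq //.
  by rewrite /f' upd_neq // def_i.
have f'r : upd f' a r =1 f by move=> i; rewrite /f' /upd; case: eqP => // ->.
rewrite addr0 -/gj (eq_mnr _ f'r (frefl g)).
have hr : upd h s r =1 h by rewrite -hs; exact: updid.
rewrite (eq_mnr A hr (frefl gj)) {2}/f' {3}/f' updx upd_neq // => exch.

rewrite -/f' -(ler_pM2r G'0).
(* [exch] times the pivot: its last term is [<= 0], the left side is bounded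
   below by the induction hypothesis. *)
have le1 : mnr f' g A * (A r c * mnr (upd h s r') gj A)
           <= mnr f' g A * (A r' c * mnr h gj A) by rewrite ler_pM2l.
have le2 : A r' c * (mnr (upd f' b r) g A * mnr (upd h s (f b)) gj A) <= 0.
  rewrite pmulr_rle0 // -oppr_ge0 -mulNr; exact: mulr_ge0.
rewrite -mulrA mulrCA (le_trans le1) // mulrCA exch mulrDr mulrA.
by rewrite gerDl.
Qed.
End Neville.

(** * Factorization of invertible totally nonnegative matrices *)

Section Factorization.
Variables (R : realFieldType) (n : nat).
Implicit Types (A B U : 'M[R]_n) (w : word R n).

Lemma elemK (u v : 'I_n) (t : R) A : u != v -> elem u v t *m (elem u v (- t) *m A) = A.
Proof.
move=> uv; apply/matrixP => i j; rewrite !mul_elemE.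
rewrite [v == u]eq_sym (negbTE uv); case: (i == u); rewrite /=; ring.
Qed.

Lemma elem_tr (u v : 'I_n) (t : R) : (elem u v t)^T = elem v u t.
Proof. by rewrite /elem linearD linearZ /= trmx1 trmx_delta. Qed.

Lemma unit_row A i : A \in unitmx -> exists j, A i j != 0.
Proof.
move=> uA; apply/existsP; apply: contraLR uA; rewrite negb_exists => /forallP z.
rewrite unitmxE (expand_det_row _ i) big1 ?unitr0 // => j _.
by move/(_ j): z; rewrite negbK => /eqP->; rewrite mul0r.
Qed.

Lemma tn_minor2 A (i i' j j' : 'I_n) :
  tn A -> (i < i')%N -> (j < j')%N -> A i j' * A i' j <= A i j * A i' j'.
Proof.
move=> tnA ii' jj'.
have front_sincr (x y : 'I_n) : (x < y)%N -> sincr (front x (fun _ : 'I_1 => y)).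
  by move=> xy; apply: sincr_front => // -[[]] // ? [[]].
have := tnA _ _ _ (front_sincr _ _ ii') (front_sincr _ _ jj').
rewrite /mnr (expand_det_row _ ord0) !big_ord_recl big_ord0 addr0.
rewrite !cofactor_mxsub !mxE !frontS !front0 /= /bump /= expr0 expr1 mul1r mulN1r.
rewrite /mnr !det_mx11 !mxE /= !frontS mulrN subr_ge0.
by rewrite (_ : lift _ _ = ord0) ?front0 //; exact/val_inj.
Qed.

Definition upper U := forall i j : 'I_n, (j < i)%N -> U i j = 0.

Definition nonzeros A := [set ij | A ij.1 ij.2 != 0].

(** A row operation that removes one nonzero entry. It creates no new one: where
    [A] vanishes, the new entry is [<= 0], and it is [>= 0] since the new matrix
    is totally nonnegative. *)
Lemma neville_step A : tn A -> A \in unitmx -> ~ upper A ->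
  exists r r' t, let A' := elem r r' (- t) *m A in
  [/\ r = r'.+1 :> nat, 0 < t, tn A' & nonzeros A' \proper nonzeros A].
Proof.
move=> tnA uA nupper.
pose P (j : 'I_n) := [exists i : 'I_n, (j < i)%N && (A i j != 0)].
have [j0 Pj0] : exists j0, P j0.
  apply/existsP; apply/negP => /existsP none; apply: nupper => i j ji.
  by apply/eqP; apply/negP => /negP Aij; apply: none; exists j; apply/existsP; exists i; rewrite ji.
case: (arg_minnP (fun j : 'I_n => val j) Pj0) => c /existsP[i0 Pi0] c_min.
case: (@arg_maxnP _ i0 (fun i : 'I_n => (c < i)%N && (A i c != 0)) (fun i : 'I_n => val i) Pi0)
  => r /andP[cr Arc] r_max.
have left_zero (i j : 'I_n) : (j < c)%N -> (j < i)%N -> A i j = 0.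
  move=> jc ji; apply/eqP; apply: contraLR jc => Aij; rewrite -leqNgt.
  by apply: c_min; apply/existsP; exists i; rewrite ji.
have below_zero (i : 'I_n) : (r < i)%N -> A i c = 0.
  move=> ri; apply/eqP; apply: contraLR (ri) => Aic; rewrite -leqNgt.
  by apply: r_max; rewrite Aic (ltn_trans cr ri).
have r'n : (r.-1 < n)%N by have := ltn_ord r; lia.
pose r' := Ordinal r'n; have rr' : r = r'.+1 :> nat by rewrite /=; lia.
have neq_rr' : r != r' by rewrite -val_eqE /= rr' /=; lia.
have {}Arc : 0 < A r c by rewrite lt_def Arc tn_ge0.
(* Otherwise the minors of rows [r'], [r] and columns [c], [j] would make row [r']
   vanish. *)
have pivot : 0 < A r' c.
  rewrite lt_def tn_ge0 // andbT; apply/eqP => Ar'c.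
  have [j] := unit_row r' uA; case: (ltngtP j c) => [jc|cj|/val_inj->].
  - by rewrite left_zero ?eqxx //; move: rr' cr jc; lia.
  - have := @tn_minor2 A r' r c j tnA; rewrite rr' ltnSn cj Ar'c mul0r => /(_ isT isT).
    by rewrite pmulr_lle0 // => le0; rewrite eq_le le0 tn_ge0.
  - by rewrite Ar'c eqxx.
exists r, r', (A r c / A r' c) => /=; set t := _ / _; set A' := _ *m _.
have t0 : 0 < t by exact: divr_gt0.
have tnA' : tn A'.
  move=> k f g fP gP; case: (pickP (fun a => f a == r)) => [a /eqP fa|fr]; last first.
    by rewrite mnr_elem_out ?tnA // => a; rewrite fr.
  rewrite /A' -{1}fa mnr_elem; last exact: sincr_inj.
  rewrite mulNr subr_ge0 /t mulrAC ler_pdivrMr // [leRHS]mulrC.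
  case: (pickP (fun b => f b == r')) => [b /eqP fb|fr'].
    have ab : b != a by apply: contraNneq neq_rr' => ab; rewrite -fa -fb ab.
    rewrite (@mnr_dup _ _ _ _ _ _ _ b a) ?mulr0 ?updx ?upd_neq //.
    by rewrite mulr_ge0 ?tnA // ltW.
  apply: neville_minor => // b ba; have := fP _ _ ba; rewrite fa rr' ltnS leq_eqVlt.
  by case/predU1P => // /val_inj/eqP; rewrite fr'.
split=> //; apply/properP; split.
  apply/subsetP => -[i j]; rewrite !inE /=; apply: contra_neq => Aij.
  apply/eqP; rewrite eq_le tn_ge0 // andbT mul_elemE Aij add0r.
  by case: (i == r); rewrite ?mul0r // mul1r mulNr oppr_le0 mulr_ge0 ?tn_ge0 ?ltW.
exists (r, c); rewrite !inE /=; first by rewrite gt_eqF.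
by rewrite mul_elemE eqxx mul1r mulNr /t divfK ?subrr ?eqxx // gt_eqF.
Qed.

(** That zero entries stay zero makes the result diagonal when [A] is lower
    triangular. *)
Lemma neville A : tn A -> A \in unitmx ->
  exists w U, [/\ lowering w, A = act w U, tn U /\ U \in unitmx,
    upper U & forall i j, A i j = 0 -> U i j = 0].
Proof.
move: {2}#|_|.+1 (ltnSn #|nonzeros A|) => N; elim: N A => // N IH A AN tnA uA.
have [/forallP up|nup] := boolP [forall i : 'I_n, forall j : 'I_n, (j < i)%N ==> (A i j == 0)].
  exists [::], A; split=> // i j ji.
  by apply/eqP; have /forallP/(_ j)/implyP := up i; apply.
have [|r [r' [t [rr' t0 tnA' sub]]]] := neville_step tnA uA.
  move=> up; case/negP: nup; apply/forallP => i; apply/forallP => j; apply/implyP => ji.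
  by rewrite up.
set A' := _ *m A in tnA' sub.
have neq_rr' : r != r' by rewrite -val_eqE /= rr'; lia.
have defA : A = elem r r' t *m A' by rewrite elemK.
have uA' : A' \in unitmx by move: uA; rewrite {1}defA unitmx_mul => /andP[].
have A'N : (#|nonzeros A'| < N)%N by exact: leq_trans (proper_card sub) _.
have [w [U [wP defA' [tnU uU] upU zU]]] := IH A' A'N tnA' uA'.
exists ((r, r', t) :: w), U; split=> //=.
- by move=> e; rewrite inE => /predU1P[->|/wP].
- by rewrite {1}defA defA'.
- move=> i j Aij; apply: zU; apply/eqP; apply: contraTT sub => A'ij.
  apply/negP => /proper_sub/subsetP/(_ (i, j)); rewrite !inE /= => /(_ A'ij).
  by rewrite Aij eqxx.
Qed.

Definition transpose_word w : word R n := rev [seq (e.1.2, e.1.1, e.2) | e <- w].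

Lemma act_tr w : (act w 1%:M)^T = act (transpose_word w) 1%:M.
Proof.
elim: w => [|e w IH] /=; first exact: trmx1.
rewrite trmx_mul IH elem_tr /transpose_word /= rev_cons -cats1 act_cat /= mulmx1.
by rewrite -act_mul.
Qed.

Lemma lowering_transpose w : raising w -> lowering (transpose_word w).
Proof. by move=> wP e; rewrite mem_rev => /mapP[x /wP[? ?] ->]. Qed.

Lemma raising_transpose w : lowering w -> raising (transpose_word w).
Proof. by move=> wP e; rewrite mem_rev => /mapP[x /wP[? ?] ->]. Qed.

Lemma transpose_wordK : involutive transpose_word.
Proof.
move=> w; rewrite /transpose_word map_rev revK -map_comp.
by rewrite -[RHS]map_id; apply: eq_map => -[[]].
Qed.

Definition factored A wl (d : 'rV[R]_n) wr :=
  [/\ A = act wl (diag_mx d *m act wr 1%:M),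
      lowering wl, raising wr & forall i, 0 < d 0 i].

Lemma factored_tr A wl d wr : factored A wl d wr ->
  factored A^T (transpose_word wr) d (transpose_word wl).
Proof.
case=> -> wlP wrP dP; split=> //; [|exact: lowering_transpose|exact: raising_transpose].
by rewrite act_mul 2!trmx_mul tr_diag_mx !act_tr -mulmxA -act_mul.
Qed.

(** The Loewner-Whitney theorem: elimination below the diagonal leaves an upper
    triangular matrix, whose transpose is eliminated in the same way. *)
Lemma factorization A : tn A -> A \in unitmx -> exists wl d wr, factored A wl d wr.
Proof.
move=> tnA uA; have [w [U [wP defA [tnU uU] upU _]]] := neville tnA uA.
have uU' : U^T \in unitmx by rewrite unitmx_tr.
have [w' [T [w'P defU [tnT uT] upT zT]]] := neville (tn_tr tnU) uU'.
pose d := \row_i T i i.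
have defT : T = diag_mx d.
  apply/matrixP => i j; rewrite !mxE; have [<-//|] := eqVneq i j.
  rewrite -val_eqE /= mulr0n neq_ltn => /orP[ij|]; last exact: upT.
  by apply: zT; rewrite mxE; exact: upU.
have dP i : 0 < d 0 i.
  rewrite mxE lt_def tn_ge0 // andbT; apply: contraTneq uT => Tii.
  by rewrite unitmxE defT det_diag (bigD1 i) //= mxE Tii mul0r unitr0.
exists w, d, (transpose_word w'); split=> //; last exact: raising_transpose.
by rewrite {1}defA -act_tr -[U]trmxK defU (act_mul w') defT trmx_mul tr_diag_mx.
Qed.

Lemma mnr_diag k (f g : 'I_k -> 'I_n) (d : 'rV[R]_n) B :
  mnr f g (diag_mx d *m B) = \prod_i d 0 (f i) * mnr f g B.
Proof.
rewrite /mnr (_ : mxsub _ _ _ = diag_mx (\row_i d 0 (f i)) *m mxsub f g B).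
  by rewrite det_mulmx det_diag; under eq_bigr => i _ do rewrite mxE.
by rewrite mul_diag_mx; apply/matrixP => i j; rewrite mul_diag_mx !mxE.
Qed.

Lemma mnr_diag_gt0 k (f g : 'I_k -> 'I_n) (d : 'rV[R]_n) B :
  (forall i, 0 < d 0 i) -> (0 < mnr f g (diag_mx d *m B)) = (0 < mnr f g B).
Proof. by move=> dP; rewrite mnr_diag pmulr_rgt0 // prodr_gt0. Qed.

Lemma tn_diag (d : 'rV[R]_n) B : (forall i, 0 < d 0 i) -> tn B -> tn (diag_mx d *m B).
Proof.
by move=> dP tnB k f g fP gP; rewrite mnr_diag mulr_ge0 ?tnB // prodr_ge0 // => i _; exact: ltW.
Qed.

Lemma factored_mul_tn A wl d wr B : factored A wl d wr -> tn B -> tn (A *m B).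
Proof.
case=> -> wlP wrP dP tnB; rewrite act_mul -2!mulmxA -!act_mul.
by apply: act_tn; [exact: pos_lowering|apply: tn_diag => //; apply: act_tn => //; exact: pos_raising].
Qed.

Lemma act_unit w : pos_word w -> act w 1%:M \in unitmx.
Proof.
elim: w => [|e w IH] wP /=; first exact: unitmx1.
have uv : e.1.1 != e.1.2.
  by have [] := wP e (mem_head _ _); rewrite -val_eqE /adj /=; lia.
rewrite unitmx_mul IH ?andbT; last by move=> x xw; apply: wP; rewrite inE xw orbT.
suff : elem e.1.1 e.1.2 e.2 *m (elem e.1.1 e.1.2 (- e.2) *m 1%:M) \in unitmx.
  by rewrite unitmx_mul => /andP[].
by rewrite elemK // unitmx1.
Qed.

Lemma factored_unit A wl d wr : factored A wl d wr -> A \in unitmx.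
Proof.
case=> -> /pos_lowering wlP /pos_raising wrP dP.
rewrite act_mul !unitmx_mul !act_unit // andbT unitmxE det_diag unitfE.
by apply/prodf_neq0 => i _; rewrite gt_eqF.
Qed.

(** Minors of [A *m B] are reached by a journey down the letters of [wl] followed
    by a journey up those of [wr]; the diagonal factor only rescales. *)
Lemma factored_gt0 A wl d wr k (f g h h' : 'I_k -> 'I_n) B :
  factored A wl d wr -> tn B -> sincr f -> sincr h' ->
  reach wl f g -> reach wr g h -> 0 < mnr h h' B -> 0 < mnr f h' (A *m B).
Proof.
case=> -> wlP wrP dP tnB fP h'P fg gh hh'; rewrite act_mul -2!mulmxA -!act_mul.
have tnB' : tn (act wr B) by apply: act_tn => //; exact: pos_raising.
apply: act_gt0 (fg) _ => //; [exact: pos_lowering|exact: tn_diag|].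
rewrite mnr_diag_gt0 //; apply: act_gt0 gh hh' => //; first exact: pos_raising.
exact: reach_sincr fP fg.
Qed.

Lemma factored_inv A wl d wr k (f h : 'I_k -> 'I_n) :
  factored A wl d wr -> sincr f -> sincr h -> 0 < mnr f h A ->
  exists g, [/\ sincr g, reach wl f g & reach wr g h].
Proof.
case=> -> wlP wrP dP fP hP.
have tnW : tn (act wr (1%:M : 'M[R]_n)) by apply: act_tn; [exact: pos_raising | exact: tn1].
case/(act_inv (pos_lowering wlP) (tn_diag dP tnW) fP hP) => g [gP fg].
rewrite mnr_diag_gt0 //.
case/(act_inv (pos_raising wrP) (@tn1 _ _) gP hP) => h' [h'P gh'].
move=> h'h; exists g; split=> //.
by have {}h'h := mnr_one_neq0 h'P hP (lt0r_neq0 h'h); exact: (reach_eq (frefl g)) h'h gh'.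
Qed.

End Factorization.

(** * The race of the particles *)

Section Schedule.
Variables (n k : nat) (s : seq nat).
Hypothesis s_complete : forall c, (c.+1 < n)%N -> c \in s.
Hypothesis kn : (0 < k < n)%N.
Local Open Scope nat_scope.

Let l := size s.
Let pos c := index c s.

(* [s] lists the sources of a word of up-moves, which is used over and over.
   Time is counted in letters, so that a round takes [l] time units. Particles
   only use the first occurrence of a letter: they cross gap [c], from position
   [c] to [c.+1], at times that are [pos c] modulo [l]. *)

Definition descents c := \sum_(j < c) (pos j.+1 < pos j).

(** When a single particle that starts at position [0] and never waits crosses
    gap [c]: every descent costs it one more round. *)
Definition start c := descents c * l + pos c.

(** The position at time [X] of this single particle. *)
Definition passed X := find (fun c => X <= start c) (iota 0 n.-1).

(** Particle [q] imitates the single particle [k.-1 - q] rounds late, all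
    particles being early by [descents k.-1] rounds, so that the topmost one
    crosses its first gap [k.-1] in round [0]. Truncation at [0] is harmless,
    since [passed 0 = 0]. *)
Definition clock q t := t + (descents k.-1 + q) * l - k.-1 * l.

(** Position of particle [q]: it waits at [q] for the single particle it imitates
    to come by, and leaves it at its destination [q + (n - k)]. *)
Definition site q t := minn (q + (n - k)) (maxn q (passed (clock q t))).

Lemma descentsS c : descents c.+1 = descents c + (pos c.+1 < pos c).
Proof. by rewrite /descents big_ord_recr. Qed.

Lemma descents_mono c d : c <= d -> descents c <= descents d <= descents c + (d - c).
Proof.
move=> /subnK <-; elim: (d - c) => [|i]; first by rewrite add0n subnn addn0 leqnn.
by rewrite !addnK addSn descentsS; case: (_ < _); lia.
Qed.

Lemma pos_lt c : c.+1 < n -> pos c < l.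
Proof. by move/s_complete; rewrite index_mem. Qed.

Lemma pos_neq c : c.+2 < n -> pos c != pos c.+1.
Proof.
move=> cn; apply/negP => /eqP e; have /s_complete c_s : c.+1 < n by lia.
have := nth_index 0 c_s; rewrite -/(pos c) e nth_index; last exact: s_complete.
by move/eqP; rewrite eq_sym -[c.+1]addn1 -[in X in X == _](addn0 c) eqn_add2l.
Qed.

(** Consecutive starts are less than one round apart. The lower bound makes
    [passed] count gaps, the upper one keeps the particles, which run one round
    apart, at distinct positions. *)
Lemma startS c : c.+2 < n -> start c < start c.+1 < start c + l.
Proof.
move=> cn; have := pos_neq cn; have := @pos_lt c.+1 cn; have := @pos_lt c ltac:(lia).
by rewrite /start descentsS mulnDl; case: (ltngtP (pos c.+1) (pos c)) => //= ? ? ? _; lia.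
Qed.

Lemma start_lt c d : c < d -> d.+1 < n -> start c < start d.
Proof.
move=> cd; rewrite -(subnK cd); elim: (d - c.+1) => [|i IH] dn.
  by have /andP[] := startS dn.
by apply: ltn_trans (IH _) _; [lia | have /andP[] := startS dn].
Qed.

Lemma passed_le X : passed X <= n.-1.
Proof. by rewrite -[n.-1](size_iota 0); exact: find_size. Qed.

Lemma ltn_passed c X : c.+1 < n -> (c < passed X) = (start c < X).
Proof.
move=> cn; apply/idP/idP => [c_lt|].
  have := before_find 0 c_lt; rewrite nth_iota ?add0n; last by lia.
  by move/negbT; rewrite -ltnNge.
apply: contraTT; rewrite -!leqNgt => pc.
have pn : passed X < n.-1 by lia.
have := pn; rewrite -[ltnRHS](size_iota 0) -has_find => /(nth_find 0).
rewrite -/(passed X) nth_iota ?add0n // => /leq_trans; apply.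
by move: pc; rewrite leq_eqVlt => /predU1P[->//|pc]; apply/ltnW/start_lt.
Qed.

Lemma passed0 : passed 0 = 0.
Proof. by rewrite /passed; case: n.-1. Qed.

Lemma passed_lag X : 0 < passed X < n.-1 -> passed X < passed (X + l).
Proof.
case: {-1}(passed X) (erefl (passed X)) => //= c pX cn.
have c2 : c.+2 < n by lia.
rewrite ltn_passed //; have /andP[_ lt1] := startS c2.
have : start c < X by rewrite -ltn_passed ?pX; lia.
lia.
Qed.

Lemma passedS X : passed X.+1 = passed X \/
  [/\ (passed X).+1 < n, start (passed X) = X & passed X.+1 = (passed X).+1].
Proof.
have p1 := passed_le X.+1.
have [le1|lt1] := leqP (passed X.+1) (passed X).
  left; apply/eqP; rewrite eqn_leq le1 /= leqNgt; apply/negP => lt2.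
  have p2 := passed_le X.
  have : start (passed X.+1) < X by rewrite -ltn_passed; lia.
  have : ~~ (start (passed X.+1) < X.+1) by rewrite -ltn_passed; lia.
  lia.
right; have pn : (passed X).+1 < n by lia.
have s1 : start (passed X) < X.+1 by rewrite -ltn_passed.
have s2 : ~~ (start (passed X) < X) by rewrite -ltn_passed ?ltnn.
have sX : start (passed X) = X by lia.
split=> //; apply/eqP; rewrite eqn_leq lt1 andbT leqNgt; apply/negP => lt2.
have : start (passed X).+1 < X.+1 by rewrite -ltn_passed; lia.
by have := @start_lt (passed X) (passed X).+1 (ltnSn _) ltac:(lia); lia.
Qed.

Lemma site_lt q t : q < k -> site q t < n.
Proof. by rewrite /site; lia. Qed.

Lemma site_incr q t : q.+1 < k -> site q t < site q.+1 t.
Proof.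
move=> qk; rewrite /site.
suff : [|| passed (clock q t) == 0, passed (clock q.+1 t) == n.-1
  | passed (clock q t) < passed (clock q.+1 t)] by have := passed_le (clock q.+1 t); lia.
rewrite /clock addnS mulSn; set a := t + _; set K := k.-1 * l.
rewrite -addnCA -/a; have [aK|Ka] := leqP a K.
  by rewrite (eqP aK) passed0.
have -> : l + a - K = a - K + l by lia.
have := @passed_lag (a - K); have := passed_le (a - K).
have := passed_le (a - K + l).
case: (ltngtP 0 (passed (a - K))) => //= p0; rewrite -?p0 //.
have := @ltn_passed (passed (a - K)).-1 (a - K); have := @ltn_passed n.-2 (a - K + l).
have := @ltn_passed n.-2 (a - K).
lia.
Qed.

Lemma site_step q t (c := nth 0 s (t %% l)) : q < k ->
  site q t.+1 = site q t \/ site q t = c /\ site q t.+1 = c.+1.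
Proof.
move=> qk; rewrite /site.
have [eqX|eqX] : clock q t.+1 = clock q t \/
    clock q t.+1 = (clock q t).+1 /\ clock q t + k.-1 * l = t + (descents k.-1 + q) * l.
- by rewrite /clock; lia.
- by rewrite eqX; left.
case: eqX => -> def_t; have [->|[cn sX ->]] := passedS (clock q t); first by left.
have -> : c = passed (clock q t).
  rewrite /c; suff -> : t %% l = pos (passed (clock q t)) by rewrite nth_index ?s_complete.
  rewrite -(modnMDl (descents k.-1 + q)) addnC -def_t -{1}sX /start addnAC -mulnDl.
  by rewrite modnMDl modn_small // pos_lt.
lia.
Qed.

Lemma site_start q : q < k -> site q 0 = q.
Proof.
move=> qk; rewrite /site; suff : ~~ (q < passed (clock q 0)) by lia.
rewrite ltn_passed; last lia.
rewrite -leqNgt /start /clock add0n -mulnBl.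
have /andP[_ le1] := @descents_mono q k.-1 ltac:(lia).
by apply: leq_trans (leq_addr _ _); rewrite leq_mul2r; lia.
Qed.

(** Particle [q] crosses its last gap [e = q + (n - k) - 1] in round
    [k.-1 - q + descents e - descents k.-1]. Between the gaps [k.-1] and [e] the
    number of descents grows by at least [0] and at most [1] per gap: the
    difference is at most [e - k.-1 = q + n - 2 * k] when [k.-1 <= e], and at most
    [0] otherwise. In both cases this happens before round [maxn k (n - k)]. *)
Lemma site_finish q m : q < k -> maxn k (n - k) <= m -> site q (m * l) = q + (n - k).
Proof.
move=> qk km; rewrite /site; set e := (q + (n - k)).-1.
suff : e < passed (clock q (m * l)) by rewrite /e; lia.
have en : e.+1 < n by rewrite /e; lia.
rewrite ltn_passed // /start /clock -mulnDl -mulnBl.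
apply: (@leq_trans ((descents e).+1 * l)); first by rewrite mulSn addnC ltn_add2r pos_lt.
rewrite leq_mul2r; apply/orP; right.
have [ek|ke] := leqP e k.-1.
  by have /andP[] := descents_mono ek; rewrite /e in ek *; lia.
by have /andP[] := descents_mono (ltnW ke); rewrite /e in ke *; lia.
Qed.

End Schedule.

(** * The upper bound *)

Section UpperBound.
Variables (R : realFieldType) (n : nat).
Implicit Types (A B : 'M[R]_n) (w : word R n).

Definition sources w := [seq nat_of_ord e.1.1 | e <- w].

Definition complete w := forall c, (c.+1 < n)%N -> c \in sources w.

Definition lowest k (kn : (k <= n)%N) : 'I_k -> 'I_n := widen_ord kn.

Lemma highest_lt k (kn : (k <= n)%N) (a : 'I_k) : (a + (n - k) < n)%N.
Proof. by have := ltn_ord a; lia. Qed.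

Definition highest k (kn : (k <= n)%N) (a : 'I_k) : 'I_n :=
  Ordinal (highest_lt kn a).

Lemma sincr_lowest k (kn : (k <= n)%N) : sincr (lowest kn).
Proof. by []. Qed.

Lemma sincr_highest k (kn : (k <= n)%N) : sincr (highest kn).
Proof. by move=> i j ij; rewrite /= ltn_add2r. Qed.

Definition race w k (kn : (0 < k < n)%N) t (a : 'I_k) : 'I_n :=
  Ordinal (site_lt (sources w) kn t (ltn_ord a)).

Lemma race_sincr w k (kn : (0 < k < n)%N) t : complete w -> sincr (race w kn t).
Proof.
move=> wC i [j jk] /=; elim: j jk => // j IH jk; rewrite ltnS leq_eqVlt => /predU1P[->|ij].
  exact: site_incr.
by apply: ltn_trans (IH (ltnW jk) ij) _; exact: site_incr.
Qed.

(** Induction on the letters still to be read in the round: by [site_step], the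
    letter read at time [t] is the only one that the change of the positions at
    this time requires. *)
Lemma race_reach w k (kn : (0 < k < n)%N) j : raising w -> complete w ->
  reach w (race w kn (j * size w)) (race w kn (j.+1 * size w)).
Proof.
move=> wP wC.
suff main p : (p <= size w)%N ->
    reach (drop (size w - p) w) (race w kn (j * size w + (size w - p)))
      (race w kn (j.+1 * size w)).
  by have := main _ (leqnn _); rewrite subnn drop0 addn0.
elim: p => [_|p IH pw].
  by rewrite subn0 drop_size addnC -mulSn.
have eqS : (size w - p = (size w - p.+1).+1)%N by lia.
have iw : (size w - p.+1 < size w)%N by lia.
have e0 : 'I_n * 'I_n * R by case: (w) iw.
rewrite (drop_nth e0) //= -eqS; eexists; split; last exact: IH (ltnW pw).
  exact: race_sincr.
move=> a; set e := nth e0 w _; have [ve _] : e.1.2 = e.1.1.+1 :> nat /\ 0 < e.2.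
  by apply: wP; exact: mem_nth.
have := @site_step n k (sources w) wC kn a (j * size w + (size w - p.+1)) (ltn_ord a).
rewrite /sources size_map modnMDl modn_small // (nth_map e0) // -/e -addnS -eqS.
by case=> [?|[? ?]]; [left|right; split]; apply/val_inj; rewrite /= ?ve.
Qed.

Lemma tnX A wl d wr m : factored A wl d wr -> tn (A ^+ m).
Proof.
move=> fA; elim: m => [|m IH]; first exact: tn1.
by rewrite exprS; exact: factored_mul_tn fA IH.
Qed.

Lemma corner_gt0 A wl d wr k (kn : (0 < k < n)%N) (kn' : (k <= n)%N) m :
  factored A wl d wr -> complete wr -> (maxn k (n - k) <= m)%N ->
  0 < mnr (lowest kn') (highest kn') (A ^+ m).
Proof.
move=> fA wC km; have [_ _ wP _] := fA.
have main i j : 0 < mnr (race wr kn (j * size wr)) (race wr kn ((j + i) * size wr)) (A ^+ i).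
  elim: i j => [|i IH] j.
    by rewrite addn0 mnr_one ?ltr01 //; apply: sincr_inj; exact: race_sincr.
  rewrite exprS addnS -addSn.
  apply: (factored_gt0 fA (tnX i fA) _ _ (reach_refl _ _) (race_reach _ _ _ _) (IH j.+1)) => //;
    exact: race_sincr.
have := main m 0; rewrite mul0n add0n (@eq_mnr _ _ _ _ _ (lowest kn') _ (highest kn')) //.
  by move=> a; apply/val_inj; rewrite /= site_start.
move=> a; apply/val_inj => /=; rewrite -(size_map (fun e => nat_of_ord e.1.1) wr).
by rewrite site_finish.
Qed.

(** A lowering word cannot move the lowest selection, so the journey behind the
    first corner minor takes the raising word all the way up; dually the other
    one takes the lowering word all the way down. Cut short, these journeys lead
    from any selection down to the lowest one and from there up to any other. *)
Lemma corners_suffice A wl d wr k (kn : (k <= n)%N) : factored A wl d wr ->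
  0 < mnr (lowest kn) (highest kn) A -> 0 < mnr (highest kn) (lowest kn) A ->
  forall f g : 'I_k -> 'I_n, sincr f -> sincr g -> 0 < mnr f g A.
Proof.
move=> fA up down f g fP gP; have [_ wlP wrP _] := fA.
have lowP := sincr_lowest kn; have highP := sincr_highest kn.
have low_le (h : 'I_k -> 'I_n) : sincr h -> forall a, (lowest kn a <= h a)%N.
  exact: sincr_ge.
have le_high (h : 'I_k -> 'I_n) : sincr h -> forall a, (h a <= highest kn a)%N.
  by move=> hP a; have := sincr_le hP a; rewrite /=; lia.
have [h [hP low_h h_high]] := factored_inv fA lowP highP up.
have [h' [h'P high_h' h'_low]] := factored_inv fA highP lowP down.
have hE : h =1 lowest kn.
  move=> a; apply/val_inj/eqP; rewrite eqn_leq (reach_lowering wlP low_h).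
  exact: low_le.
have h'E : h' =1 lowest kn.
  move=> a; apply/val_inj/eqP; rewrite eqn_leq (reach_raising wrP h'_low).
  exact: low_le.
have f_low : reach wl f (lowest kn).
  apply: reach_eq (reach_clamp (pos_lowering wlP) fP high_h') => a; rewrite /clamp.
    by apply/val_inj; have := le_high _ fP a => le; case: leqP => //= ge; move: le ge => /=; lia.
  by rewrite h'E low_le.
have low_g : reach wr (lowest kn) g.
  apply: reach_eq (reach_clamp (pos_raising wrP) gP h_high) => a; rewrite /clamp.
    by rewrite hE low_le.
  by apply/val_inj; have := le_high _ gP a => le; case: leqP => //= ge; move: le ge => /=; lia.
have := factored_gt0 fA (@tn1 R n) fP gP f_low low_g; rewrite mulmx1; apply.
by rewrite mnr_one //; exact: sincr_inj.
Qed.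

Lemma trmxX A m : (A ^+ m)^T = A^T ^+ m.
Proof.
elim: m => [|m IH]; first by rewrite !expr0 trmx1.
by rewrite exprSr exprS trmx_mul IH.
Qed.

Lemma unitmxX A m : A \in unitmx -> A ^+ m \in unitmx.
Proof.
move=> uA; elim: m => [|m IH]; first exact: unitmx1.
by rewrite exprS unitmx_mul uA.
Qed.

(** The power is factored anew, because the journeys through the word of [A],
    repeated [m] times, alternate between moves down and up.
    Its lower left corner is the upper right corner of a power of the transpose. *)
Lemma minors_gt0 A wl d wr k m : factored A wl d wr ->
  complete wr -> complete (transpose_word wl) ->
  (0 < k < n)%N -> (maxn k (n - k) <= m)%N ->
  forall f g : 'I_k -> 'I_n, sincr f -> sincr g -> 0 < mnr f g (A ^+ m).
Proof.
move=> fA wrC wlC kn km; have kn' : (k <= n)%N by case/andP: kn => _ /ltnW.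
have [wl' [d' [wr' fAm]]] := factorization (tnX m fA) (unitmxX m (factored_unit fA)).
apply: (corners_suffice (kn := kn') fAm); first exact: corner_gt0 fA wrC km.
by rewrite -mnr_tr trmxX; exact: corner_gt0 (factored_tr fA) wlC km.
Qed.

(** Without the letter for the gap above [c], all powers of [A] vanish at rows up
    to [c] and columns beyond: no particle crosses this gap upwards. *)
Lemma positive_complete A wl d wr m : factored A wl d wr ->
  (forall i j, 0 < (A ^+ m) i j) -> complete wr.
Proof.
move=> [defA wlP wrP _] Am c cn; apply: contraPT (Am (Ordinal (ltnW cn)) (Ordinal cn)) => c_out.
pose closed B := forall p q : 'I_n, (p <= c < q)%N -> B p q = 0.
have closed1 a : closed (diag_mx a).
  by move=> p q /andP[pc cq]; rewrite mxE -val_eqE /= ltn_eqF ?mulr0n //; exact: leq_ltn_trans cq.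
have closedM B C : closed B -> closed C -> closed (B *m C).
  move=> cB cC p q /andP[pc cq]; rewrite mxE big1 // => i _.
  have [ic|ci] := leqP i c; first by rewrite cC ?mulr0 // ic.
  by rewrite cB ?mul0r // pc.
have closed_act w B : (forall e, e \in w -> (e.1.1 <= c -> e.1.2 <= c)%N) ->
    closed B -> closed (act w B).
  elim: w => //= e w IH wc cB p q pq; rewrite mul_elemE.
  have cw : closed (act w B) by apply: IH => // x xw; apply: wc; rewrite inE xw orbT.
  rewrite cw // add0r; case: eqP => [pe|]; last by rewrite mul0r.
  by rewrite cw ?mulr0 //; case/andP: pq => pc ->; rewrite andbT wc ?mem_head // -pe.
have cA : closed A.
  rewrite defA; apply: (closed_act) => [e /wlP[-> _]|]; first lia.
  apply: closedM => //; apply: (closed_act) => [e ew|]; last first.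
    by rewrite -diag_const_mx.
  have [-> _] := wrP e ew; rewrite leq_eqVlt => /predU1P[ec|//].
  by case/mapP: c_out; exists e.
have cX i : closed (A ^+ i).
  elim: i => [|i IH]; first by rewrite -[A ^+ 0]/(1%:M) -diag_const_mx.
  by rewrite exprS; exact: closedM.
by rewrite cX /= ?leqnn ?ltxx.
Qed.

End UpperBound.

(** * Sharpness *)

Section Banded.
Variables (R : realFieldType) (n : nat).
Implicit Types (A B : 'M[R]_n).

Definition banded b A := forall i j : 'I_n, (i + b < j)%N -> A i j = 0.

Lemma banded_mul b b' A B : banded b A -> banded b' B -> banded (b + b') (A *m B).
Proof.
move=> bA bB i j ij; rewrite mxE big1 // => l _.
have [il|li] := ltnP (i + b) l; first by rewrite bA ?mul0r.
by rewrite bB ?mulr0 //; lia.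
Qed.

Lemma bandedX A m : banded 1 A -> banded m (A ^+ m).
Proof.
move=> bA; elim: m => [|m IH].
  by move=> i j ij; rewrite mxE -val_eqE /= ltn_eqF //; rewrite addn0 in ij.
by rewrite exprS -add1n; exact: banded_mul.
Qed.

Lemma act_upper (w : word R n) : (forall e, e \in w -> (e.1.1 < e.1.2)%N) ->
  upper (act w 1%:M).
Proof.
elim: w => [|e w IH] wP i j ji /=; first by rewrite mxE -val_eqE /= gtn_eqF.
have upw : upper (act w (1%:M : 'M[R]_n)).
  by apply: IH => x xw; apply: wP; rewrite inE xw orbT.
rewrite mul_elemE upw // add0r; case: eqP => [ie|]; last by rewrite mul0r.
have := wP e (mem_head _ _); rewrite -ie => ie'.
by rewrite upw ?mulr0 //; exact: ltn_trans ji ie'.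
Qed.

Lemma upper_tr_banded A : upper A -> banded 0 A^T.
Proof. by move=> uA i j; rewrite addn0 mxE; exact: uA. Qed.

(** The first row of [A ^+ m] does not reach the last [k] columns. *)
Lemma banded_corner A m k (kn : (k <= n)%N) : (0 < k)%N -> (m < n - k)%N ->
  banded 1 A -> mnr (lowest kn) (highest kn) (A ^+ m) = 0.
Proof.
case: k kn => // k kn _ mk bA; rewrite /mnr (expand_det_row _ ord0) big1 // => j _.
by rewrite mxE (bandedX bA) ?mul0r //= add0n; lia.
Qed.

(** The first row of [A ^- m] is supported on the first [k] positions and shows
    that the first [k] rows of [A ^+ m] become dependent once the first column is
    dropped. *)
Lemma inv_banded_corner A H m k (kn : (k <= n)%N) : (m < k)%N -> (k < n)%N ->
  H *m A = 1%:M -> banded 1 H -> mnr (lowest kn) (highest kn) (A ^+ m) = 0.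
Proof.
move=> mk k_lt_n HA bH; have bHm := @bandedX H m bH.
have HAm : H ^+ m *m A ^+ m = 1%:M.
  elim: (m) => [|i IH]; first by rewrite !expr0 mul1mx.
  by rewrite exprSr exprS mulmxA -(mulmxA (H ^+ i)) HA mulmx1.
have n0 : (0 < n)%N by lia.
pose o := Ordinal n0.
have support j : \sum_(a < k) (H ^+ m) o (lowest kn a) * (A ^+ m) (lowest kn a) j
                 = (o == j)%:R.
  have -> : (o == j)%:R = (H ^+ m *m A ^+ m) o j by rewrite HAm mxE.
  rewrite mxE (bigID (fun i : 'I_n => (i < k)%N)) /= [X in _ + X]big1 ?addr0.
    by rewrite (big_ord_narrow kn).
  by move=> i; rewrite -leqNgt => ki; rewrite bHm ?mul0r //= add0n; lia.
apply/eqP/det0P; exists (\row_a (H ^+ m) o (lowest kn a)).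
  apply/eqP => /rowP z; have := support o; rewrite eqxx big1 => [/eqP|a _].
    by rewrite eq_sym oner_eq0.
  by have := z a; rewrite !mxE => ->; rewrite mul0r.
apply/rowP => j; rewrite !mxE.
under eq_bigr => a _ do rewrite !mxE.
rewrite support -val_eqE /=; case: eqP => //; lia.
Qed.

End Banded.

Section Example.
Variables (R : realFieldType) (n : nat).

Definition up_move (t : R) c : 'I_n.+1 * 'I_n.+1 * R := (inord c, inord c.+1, t).

Definition descending t m : word R n.+1 := [seq up_move t c | c <- rev (iota 0 m)].

Lemma descendingS t m : descending t m.+1 = up_move t m :: descending t m.
Proof. by rewrite /descending -[in iota 0 m.+1](addn1 m) iotaD rev_cat. Qed.

Lemma mem_descending t e :
  e \in descending t n -> e.1.2 = e.1.1.+1 :> nat /\ e.2 = t.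
Proof.
by case/mapP => c; rewrite mem_rev mem_iota => cn ->; rewrite /= !inordK //; lia.
Qed.

Lemma descending_complete t : complete (descending t n).
Proof.
move=> c cn; apply/mapP; exists (up_move t c); last by rewrite /= inordK //; lia.
by apply: map_f; rewrite mem_rev mem_iota.
Qed.

(** The letters act from the last one on, that is from gap [0] upwards, and each
    adds to row [m] a row [m.+1] that is still that of the identity. *)
Lemma descending_rows t m : (m <= n)%N ->
  banded 1 (act (descending t m) 1%:M) /\
  forall i j : 'I_n.+1, (m <= i)%N -> act (descending t m) 1%:M i j = (i == j)%:R.
Proof.
elim: m => [_|m IH mn].
  by split=> i j; rewrite mxE // -val_eqE /= => ij; rewrite ltn_eqF //; lia.
have [bm idm] := IH (ltnW mn); rewrite descendingS; split=> i j ij /=; rewrite mul_elemE.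
  rewrite bm // add0r; case: eqP => [im|]; last by rewrite mul0r.
  move: ij; rewrite im inordK // => [ij|]; last by lia.
  rewrite idm ?inordK // -val_eqE /= inordK // ltn_eqF ?mulr0 //; lia.
have /negbTE-> : i != inord m by rewrite -val_eqE /= inordK //; lia.
by rewrite idm ?mul0r ?addr0 // ltnW.
Qed.

Lemma descending_banded t : banded 1 (act (descending t n) 1%:M).
Proof. by have [] := descending_rows t (leqnn n). Qed.

Lemma ascending_inv m : (m <= n)%N ->
  act (rev (descending 1 m)) 1%:M *m act (descending (-1) m) 1%:M = 1%:M.
Proof.
elim: m => [_|m IH mn]; first by rewrite mul1mx.
rewrite !descendingS rev_cons -cats1 act_cat act_mul /= mulmx1 -mulmxA elemK.
  exact: IH (ltnW mn).
by rewrite -val_eqE /= !inordK; lia.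
Qed.

(** One up-move per gap in each round, and the opposite down-moves. In descending
    order a particle advances by at most one position per round, and needs
    [n.+1 - k] rounds. In ascending order it can run through, but the particle
    behind it has to wait for the next round, so that [k] rounds are needed. In
    terms of matrices, [A] or its inverse vanishes above the first
    superdiagonal. *)
Lemma slow_example k (kn : (k <= n.+1)%N) : (0 < k < n.+1)%N ->
  exists A wl d wr, [/\ factored A wl d wr, complete wr, complete (transpose_word wl) &
    forall m, (m < maxn k (n.+1 - k))%N ->
      mnr (lowest kn) (highest kn) (A ^+ m : 'M[R]_n.+1) = 0].
Proof.
case/andP=> k0 k_lt_n.
pose symm (w : word R n.+1) := act (transpose_word w) 1%:M *m act w 1%:M.
have symmP w : raising w -> factored (symm w) (transpose_word w) (const_mx 1) w.
  move=> wP; split=> //; [|exact: lowering_transpose|by move=> i; rewrite mxE].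
  by rewrite diag_const_mx mul1mx act_mul.
have upP (w : word R n.+1) : (forall e, e \in w -> e.1.2 = e.1.1.+1 :> nat) ->
    upper (act w 1%:M).
  by move=> wP; apply: act_upper => e /wP->.
have [le_k|lt_k] := leqP k (n.+1 - k).
  pose w := descending 1 n; have wP : raising w.
    by move=> e /mem_descending[-> ->]; rewrite ltr01.
  exists (symm w), (transpose_word w), (const_mx 1), w; split.
  - exact: symmP.
  - exact: descending_complete.
  - by rewrite transpose_wordK; exact: descending_complete.
  move=> m mk; apply: banded_corner => //.
  rewrite /symm -act_tr -[1%N]/(0 + 1)%N; apply: banded_mul; last exact: descending_banded.
  by apply/upper_tr_banded/upP => e /wP[].
pose w := rev (descending 1 n); have wP : raising w.
  by move=> e; rewrite mem_rev => /mem_descending[-> ->]; rewrite ltr01.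
have wC : complete w.
  by move=> c cn; rewrite /sources map_rev mem_rev; exact: descending_complete.
exists (symm w), (transpose_word w), (const_mx 1), w; split=> //.
- exact: symmP.
- by rewrite transpose_wordK.
move=> m mk.
set Z := act (descending (-1) n) (1%:M : 'M[R]_n.+1).
have wZ : act w 1%:M *m Z = 1%:M by exact: ascending_inv.
apply: (@inv_banded_corner _ _ _ (Z *m Z^T)) => //.
  rewrite /symm -act_tr -mulmxA (mulmxA Z^T) -trmx_mul wZ trmx1 mul1mx.
  exact: mulmx1C.
rewrite -[1%N]/(1 + 0)%N; apply: banded_mul; first exact: descending_banded.
by apply/upper_tr_banded/upP => e /mem_descending[].
Qed.

End Example.

(** * Strictly increasing families and oscillatory matrices *)

Section Interface.
Variables (R : realType) (n : nat).
Implicit Types (A : 'M[R]_n).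

Lemma strictly_increasingP k (f : {ffun 'I_k -> 'I_n}) :
  reflect (sincr f) (strictly_increasing f).
Proof.
apply: (iffP forallP) => [fP i j|fP i]; last by apply/forallP => j; apply/implyP; exact: fP.
by have /forallP/(_ j)/implyP := fP i.
Qed.

Lemma minor_finfun k (f g : 'I_k -> 'I_n) A : minor (finfun f) (finfun g) A = mnr f g A.
Proof. by rewrite /minor mxsub_ffun. Qed.

Lemma sincr_finfun k (f : 'I_k -> 'I_n) : sincr f -> strictly_increasing (finfun f).
Proof. by move=> fP; apply/strictly_increasingP; apply: eq_sincr fP => i; rewrite ffunE. Qed.

Lemma pos_minorsP k A :
  reflect (forall f g : 'I_k -> 'I_n, sincr f -> sincr g -> 0 < mnr f g A)
    (pos_minors k A).
Proof.
apply: (iffP forallP) => [pA f g fP gP|pA f].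
  have /forallP/(_ (finfun g))/implyP := pA (finfun f).
  by rewrite minor_finfun !sincr_finfun //; apply.
apply/forallP => g; apply/implyP => /andP[/strictly_increasingP fP /strictly_increasingP gP].
exact: pA.
Qed.

Lemma nonneg_minorsP k A :
  reflect (forall f g : 'I_k -> 'I_n, sincr f -> sincr g -> 0 <= mnr f g A)
    (nonneg_minors k A).
Proof.
apply: (iffP forallP) => [pA f g fP gP|pA f].
  have /forallP/(_ (finfun g))/implyP := pA (finfun f).
  by rewrite minor_finfun !sincr_finfun //; apply.
apply/forallP => g; apply/implyP => /andP[/strictly_increasingP fP /strictly_increasingP gP].
exact: pA.
Qed.

Lemma totally_positive_intro A : tn A -> A \in unitmx ->
  (forall k, (0 < k < n)%N -> pos_minors k A) -> totally_positive A.
Proof.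
move=> tnA uA pA k; case: (ltngtP k n) => [kn|nk|->].
- case: k kn => [|k] kn; last by apply: pA.
  by apply/pos_minorsP => f g _ _; rewrite /mnr det_mx00 ltr01.
- apply/pos_minorsP => f g fP _; have k0 : (0 < k)%N by lia.
  by have := sincr_le fP (Ordinal k0) => /=; lia.
apply/pos_minorsP => f g fP gP.
have idP h : sincr h -> h =1 @id 'I_n.
  by move=> hP i; apply/val_inj; have := sincr_ge hP i; have := sincr_le hP i; rewrite /=; lia.
rewrite lt_def tnA // andbT (eq_mnr A (idP _ fP) (idP _ gP)) /mnr mxsub_id //.
by rewrite -unitfE -unitmxE.
Qed.

(** A word without the move over some gap would leave a zero block in all powers
    of [A], so the words of an oscillatory matrix are complete. *)
Lemma oscillatory_factored A : (0 < n)%N -> oscillatory A ->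
  exists wl d wr, [/\ factored A wl d wr, complete wr & complete (transpose_word wl)].
Proof.
move=> n0 [tnA [m [m0 tpAm]]].
have tnA' : tn A by move=> k; exact/nonneg_minorsP.
have uA : A \in unitmx.
  have /pos_minorsP/(_ id id) := tpAm n; rewrite /mnr mxsub_id //.
  case: m m0 {tpAm} => // m _ => /(_ (fun _ _ => id) (fun _ _ => id)) det0.
  have : A ^+ m.+1 \in unitmx by rewrite unitmxE unitfE gt_eqF.
  by rewrite exprS unitmx_mul => /andP[].
have pos i j : 0 < (A ^+ m) i j.
  by rewrite -mnr1; have /pos_minorsP := tpAm 1%N; apply=> -[[]] // ? [[]].
have [wl [d [wr fA]]] := factorization tnA' uA.
exists wl, d, wr; split=> //; first exact: positive_complete fA pos.
by apply: (@positive_complete _ _ _ _ _ _ m (factored_tr fA)) => i j; rewrite -trmxX mxE.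
Qed.

End Interface.

(** * Bound and sharpness *)

Theorem theorem5p4 (R : realType) (n : nat) (n_ge2 : (2 <= n)%N) :
  (forall (A : 'M[R]_n) (oscA : oscillatory A) (k : nat),
     (1 <= k < n)%N -> (minors_exponent oscA k <= maxn k (n - k))%N) /\
  (forall k : nat, (1 <= k < n)%N ->
     exists (A : 'M[R]_n) (oscA : oscillatory A),
       minors_exponent oscA k = maxn k (n - k)).
Proof.
have upper_bound (A : 'M[R]_n) (oscA : oscillatory A) (k : nat) :
    (1 <= k < n)%N -> (minors_exponent oscA k <= maxn k (n - k))%N.
  move=> kn; rewrite /minors_exponent; case: ex_minnP => e _; apply.
  have [|wl [d [wr [fA wrC wlC]]]] := oscillatory_factored _ oscA; first exact: ltnW.
  apply/andP; split; first by lia.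
  by apply/pos_minorsP; exact: minors_gt0 fA wrC wlC kn (leqnn _).
split=> // k kn; case: n n_ge2 upper_bound kn => // n' _ upper_bound kn.
have kn' : (k <= n'.+1)%N by lia.
have [A [wl [d [wr [fA wrC wlC slow]]]]] := slow_example R kn' kn.
have oscA : oscillatory A.
  split=> [l|]; first by apply/nonneg_minorsP; exact: (@tnX _ _ A _ _ _ 1 fA).
  exists n'.+1; split=> //; apply: totally_positive_intro; first exact: tnX fA.
    exact: unitmxX (factored_unit fA).
  move=> l ln; apply/pos_minorsP; apply: (minors_gt0 fA wrC wlC ln); lia.
exists A, oscA; apply/eqP; rewrite eqn_leq upper_bound //= leqNgt; apply/negP.
rewrite /minors_exponent; case: ex_minnP => e /andP[_ /pos_minorsP pos_e] _ /slow.
have := pos_e _ _ (sincr_lowest kn') (sincr_highest kn') => /[swap] ->.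
by rewrite ltxx.
Qed.
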